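(* Let $p_1,p_2,\ldots\in[0,1]$ and let $A_i(N)$ (for $i\ge 2$) and $F_i(N)$ (for $i\geq 1$) be the probabilities defined in the context. For every integer $i>2$ and every integer $N$, $$A_i(N)=\sum_{l=1}^{2^{i-2}}F_{i-1}(l)\,A_{i-1}(N-l),$$ while $A_2(1)=p_1$, and $A_2(N)=0$ for $N\neq 1$ (with $A_i(N)=0$ for negative $N$).
   Context: $T_i$ is the perfect binary tree with $i$ layers, numbered from the leaves (layer $1$) to the root (layer $i$). Its $2^{i-1}$ leaves carry the data fragments (binary vectors of a fixed length), and every non-leaf vertex carries the bitwise XOR of its two children's fragments. A subset of the vertices is decodable if the fragments at its vertices determine all data fragments (equivalently, the $\mathbb{F}_2$-indicator vectors of the leaf sets below its vertices span $\mathbb{F}_2^{2^{i-1}}$). Vertices in the subset are called present, the others missing. A missing-vertex path is a path in the tree (possibly a single vertex) all of whose vertices are missing. Random model: each vertex of layer $j$ is present with probability $p_j$, independently of all other vertices. Recovery cost: in a decodable subset, a data fragment whose leaf is present is recovered with $0$ communicated fragments. A data fragment whose leaf $y$ is missing is recovered by the (unique) present vertex $x$ such that there is a missing-vertex path from a child of $x$ down to $y$ (that is, the lowest present ancestor of $y$). The number of communicated fragments for this data fragment is the number of present proper descendants $z$ of $x$ such that no vertex strictly between $x$ and $z$ is present. Definitions: for $i\ge 2$, $A_i(N)$ is the probability that the random subset of $T_i$ is decodable and a particular (fixed) data fragment is recovered with $N$ communicated fragments, given that the root is present and that there is a missing-vertex path from a child of the root to the leaf of that data fragment (i.e. the root is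 declared present, the vertices on that path are declared missing, and every other vertex, if it lies in layer $j$, is present with probability $p_j$, independently of all other vertices). $F_i(N)$ is the probability that the random subset of $T_i$ is decodable and has exactly $N$ present vertices with no present (proper) ancestors. *)

(* Defs.v *)
From HB Require Import structures.
From mathcomp Require Import all_boot all_order all_algebra.
From mathcomp Require Import reals.

Set Implicit Arguments.
Unset Strict Implicit.
Unset Printing Implicit Defensive.

Import Order.TTheory GRing.Theory Num.Theory.
Local Open Scope ring_scope.

(* A vertex of the perfect binary tree with i >= 1 layers is the word of the
   left/right turns leading to it from the root: the root is the empty word,
   the leaves are the words of length i - 1, and u is an ancestor of v
   (possibly v itself) when u is a prefix of v.  For i = 0 this is junk. *)
Definition vertex (i : nat) := {bseq i.-1 of bool}.

Section Tree.
Variable i : nat.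
Implicit Types (u v w x y z c : vertex i) (S : {set vertex i}).

(* Layers are numbered from the leaves (layer 1) to the root (layer i). *)
Definition layer v : nat := (i - size v)%N.

Definition is_root v : bool := layer v == i.

Definition is_leaf v : bool := layer v == 1%N.

Definition anc u v : bool := prefix u v.

Definition proper_anc u v : bool := (u != v) && anc u v.

Definition child x c : bool := anc x c && (size c == (size x).+1).

(* z lies on the tree path going down from u to v. *)
Definition on_path u v z : bool := anc u z && anc z v.

(* Addition in 'rV['F_2]_L is the bitwise XOR. *)
Definition coded (L : nat) (f : {ffun vertex i -> 'rV['F_2]_L}) : bool :=
  [forall v, ~~ is_leaf v ==> (f v == \sum_(c | child v c) f c)].

Definition decodable (L : nat) S : bool :=
  [forall f : {ffun vertex i -> 'rV['F_2]_L},
   forall g : {ffun vertex i -> 'rV['F_2]_L},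
     [&& coded f, coded g & [forall v in S, f v == g v]] ==>
       [forall y, is_leaf y ==> (f y == g y)]].

Definition missing_path S u v : bool :=
  anc u v && [forall z, on_path u v z ==> (z \notin S)].

Definition recovers S x y : bool :=
  (x \in S) && [exists c, child x c && missing_path S c y].

(* The present proper descendants of x with no present vertex strictly between
   x and them. *)
Definition top_below S x : {set vertex i} :=
  [set z in S | proper_anc x z &&
     [forall w, proper_anc x w && proper_anc w z ==> (w \notin S)]].

(* The data fragment of the leaf y is recovered with N communicated fragments.
   This is a relation rather than a function because a missing leaf with no
   present ancestor has no recovery cost. *)
Definition recovered_with S y (N : int) : bool :=
  if y \in S then N == 0
  else [exists x, recovers S x y && (N == #|top_below S x|%:Z)].

Definition top_present S : {set vertex i} :=
  [set z in S | [forall w, proper_anc w z ==> (w \notin S)]].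

(* Probability of the event E for the random subset in which every vertex v is
   present with probability q v, independently of the others. *)
Definition prob (R : realType) (q : vertex i -> R) (E : pred {set vertex i})
    : R :=
  \sum_(S : {set vertex i} | E S)
     \prod_(v : vertex i) (if v \in S then q v else 1 - q v).

(* Presence probabilities given that the root is present and that all the
   other vertices on the path from the root to y are missing. *)
Definition cond_presence (R : realType) (p : nat -> R) y v : R :=
  if is_root v then 1 else if anc v y then 0 else p (layer v).

End Tree.

(* A_i(N), for the data fragment at the leaf y of T_i.  The number N ranges over
   the integers, so that A_i(N) = 0 for N < 0. *)
Definition A (R : realType) (p : nat -> R) (L i : nat) (y : vertex i) (N : int)
    : R :=
  prob (cond_presence p y)
    (fun S => decodable L S && recovered_with S y N).

Definition F (R : realType) (p : nat -> R) (L i : nat) (N : nat) : R :=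
  prob (fun v : vertex i => p (layer v))
    (fun S => decodable L S && (#|top_present S| == N)).

(* Main.v *)
Require Import Defs.
From HB Require Import structures.
From mathcomp Require Import all_boot all_order all_algebra.
From mathcomp Require Import reals.

Set Implicit Arguments.
Unset Strict Implicit.
Unset Printing Implicit Defensive.

Import Order.TTheory GRing.Theory Num.Theory.
Local Open Scope ring_scope.

(* Condition on the root of T_i being present and on the path from it down to
   the leaf y being missing, and let b be the child of the root on this path.
   The random subset splits into two independent subsets of the trees T_(i-1)
   below the children of the root.  It is decodable iff the subset off the path
   is decodable and the subset on the path, with b added, is decodable: the
   fragment of b is the XOR of those of the root and of the other child.  The
   cost is the number l of topmost present vertices off the path plus the cost
   of y in the tree below b with b declared present.  Summing over l gives the
   recurrence.  It also holds for i = 2 if T_1 is given cost 0, and by induction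
   it shows that A_i does not depend on the leaf. *)

(* Keeps the dimension of [vertex n.+2] in one syntactic form. *)
#[local] Arguments Nat.pred : simpl never.

(** * Splitting a tree at its root into two subtrees *)

Definition root n : vertex n.+1 := [bseq].

Definition ext n (b : bool) (v : vertex n.+1) : vertex n.+2 := [bseq of b :: v].

Definition tail n (v : vertex n.+2) : vertex n.+1 := [bseq of behead v].

Definition subtree n (b : bool) (S : {set vertex n.+2}) : {set vertex n.+1} :=
  [set v | ext b v \in S].

Lemma neq_negb (b c : bool) : c != b -> c = ~~ b.
Proof. by case: b c => [] []. Qed.

Lemma vertex_ind n (P : vertex n.+2 -> Prop) :
  P (root n.+1) -> (forall b v, P (ext b v)) -> forall v, P v.
Proof.
move=> Proot Pext v; case: v => [[|b s] sz_s] /=.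
  by rewrite (_ : Bseq _ = root n.+1) //; apply: val_inj.
by rewrite (_ : Bseq _ = ext b (Bseq (sz_s : size s <= n)%N)) //; apply: val_inj.
Qed.

Lemma vertex1_root (v : vertex 1) : v = root 0.
Proof. by apply: val_inj; case: v => [[|//]]. Qed.

Lemma ext_eq n b c (v w : vertex n.+1) :
  (ext b v == ext c w) = (b == c) && (v == w).
Proof. by rewrite -!val_eqE /= eqseq_cons. Qed.

Lemma ext_eq_root n b (v : vertex n.+1) : (ext b v == root n.+1) = false.
Proof. by rewrite -val_eqE. Qed.

Lemma tailK n b (v : vertex n.+1) : tail (ext b v) = v.
Proof. exact: val_inj. Qed.

(** The side listed first is a parameter, so that later the side containing the leaf [y] can come
    first whichever turn it is. *)
Lemma big_vertex (R : Type) (idx : R) (op : Monoid.com_law idx) n b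
    (G : vertex n.+2 -> R) :
  \big[op/idx]_v G v =
    op (G (root n.+1)) (op (\big[op/idx]_v G (ext b v))
                           (\big[op/idx]_v G (ext (~~ b) v))).
Proof.
rewrite (bigD1 (root n.+1)) //=; congr (op _ _).
rewrite (bigID (fun v : vertex n.+2 => head b v == b)) /=; congr (op _ _).
  rewrite (reindex_onto (ext b) (@tail n)) /=; last first.
    by elim/vertex_ind => [/andP[] //|c v /= /eqP->]; rewrite tailK.
  by apply: eq_bigl => v; rewrite tailK !eqxx.
rewrite (reindex_onto (ext (~~ b)) (@tail n)) /=; last first.
  elim/vertex_ind => [/andP[] //|c v /= neq_cb]; rewrite tailK.
  by case: b c neq_cb => [] [].
by apply: eq_bigl => v; rewrite tailK eqxx andbT; case: b.
Qed.

Lemma forall_vertex n b (P : pred (vertex n.+2)) :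
  [forall v, P v] =
    [&& P (root n.+1), [forall v, P (ext b v)] & [forall v, P (ext (~~ b) v)]].
Proof.
apply/forallP/and3P => [allP | [Proot /forallP Pb /forallP Pnb] v].
  by split=> //; apply/forallP.
by elim/vertex_ind: v => // c v; case: b c Pb Pnb => [] [].
Qed.

Lemma card_vertex n b (S : {set vertex n.+2}) :
  #|S| = ((root n.+1 \in S) + (#|subtree b S| + #|subtree (~~ b) S|))%N.
Proof.
rewrite -sum1_card big_mkcond (big_vertex _ b) /=.
congr (_ + (_ + _))%N.
all: rewrite -sum1_card [RHS]big_mkcond; apply: eq_bigr => v _.
all: by rewrite inE.
Qed.

Lemma anc_ext n b c (v w : vertex n.+1) :
  anc (ext b v) (ext c w) = (b == c) && anc v w.
Proof. by rewrite /anc /=; case: eqP. Qed.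

Lemma anc_root n (v : vertex n.+1) : anc (root n) v.
Proof. exact: prefix0s. Qed.

Lemma anc_refl n (v : vertex n) : anc v v.
Proof. exact: prefix_refl. Qed.

Lemma proper_anc_ext n b c (v w : vertex n.+1) :
  proper_anc (ext b v) (ext c w) = (b == c) && proper_anc v w.
Proof. by rewrite /proper_anc anc_ext ext_eq; case: eqP. Qed.

Lemma proper_anc_root n (v : vertex n.+1) :
  proper_anc (root n) v = (v != root n).
Proof. by rewrite /proper_anc anc_root andbT eq_sym. Qed.

Lemma proper_anc_to_root n (v : vertex n.+1) : proper_anc v (root n) = false.
Proof.
rewrite /proper_anc /anc prefixs0; case: eqVneq => //= neq; apply/eqP => v0.
by case/eqP: neq; apply: val_inj.
Qed.

Lemma child_ext n b c (v w : vertex n.+1) :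
  child (ext b v) (ext c w) = (b == c) && child v w.
Proof. by rewrite /child anc_ext eqSS andbA. Qed.

Lemma child_root_ext n b (v : vertex n.+1) :
  child (root n.+1) (ext b v) = (v == root n).
Proof. by rewrite /child anc_root /= eqSS size_eq0 -val_eqE. Qed.

Lemma child_to_root n (v : vertex n.+1) : child v (root n) = false.
Proof. by rewrite /child andbF. Qed.

Lemma is_leaf_ext n b (v : vertex n.+1) : is_leaf (ext b v) = is_leaf v.
Proof. by []. Qed.

Lemma is_rootE n (v : vertex n.+1) : is_root v = (v == root n).
Proof.
rewrite /is_root /layer -val_eqE /= -size_eq0.
by case: v => [[|b s]] /= sz_s; rewrite ?subn0 ?eqxx // subSS ltn_eqF // ltnS leq_subr.
Qed.

Lemma is_leaf_root n : is_leaf (root n) = (n == 0%N).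
Proof. by rewrite /is_leaf /layer subn0. Qed.

(** Inverse of cutting at the root: it glues codewords of the two subtrees and, applied to
    membership predicates, reassembles subsets. *)
Definition node (T : Type) n (b : bool) (a : T) (f g : vertex n.+1 -> T)
    (v : vertex n.+2) : T :=
  if v == root n.+1 then a else if head b v == b then f (tail v) else g (tail v).

Lemma node_root (T : Type) n b (a : T) (f g : vertex n.+1 -> T) :
  node b a f g (root n.+1) = a.
Proof. by rewrite /node eqxx. Qed.

Lemma node_ext (T : Type) n b (a : T) (f g : vertex n.+1 -> T) v :
  node b a f g (ext b v) = f v.
Proof. by rewrite /node ext_eq_root /= eqxx tailK. Qed.

Lemma node_extN (T : Type) n b (a : T) (f g : vertex n.+1 -> T) v :
  node b a f g (ext (~~ b) v) = g v.
Proof. by rewrite /node ext_eq_root /= tailK; case: b. Qed.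

(** * Codewords and decodability *)

Section Coding.
Variable L : nat.
Implicit Types n : nat.

Definition restr n b (f : {ffun vertex n.+2 -> 'rV['F_2]_L}) :
    {ffun vertex n.+1 -> 'rV['F_2]_L} := [ffun v => f (ext b v)].

Lemma coded1 (f : {ffun vertex 1 -> 'rV['F_2]_L}) : coded f.
Proof. by apply/forallP => v; rewrite (vertex1_root v) is_leaf_root. Qed.

Lemma codedE n b (f : {ffun vertex n.+2 -> 'rV['F_2]_L}) :
  coded f = [&& f (root n.+1) == f (ext b (root n)) + f (ext (~~ b) (root n)),
                coded (restr b f) & coded (restr (~~ b) f)].
Proof.
rewrite /coded (forall_vertex b) is_leaf_root /= big_mkcond (big_vertex _ b).
rewrite child_to_root /= add0r -!big_mkcond.
under eq_bigl do rewrite child_root_ext.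
under [X in _ + X]eq_bigl do rewrite child_root_ext.
rewrite !big_pred1_eq.
congr [&& _, _ & _]; apply: eq_forallb => v; rewrite is_leaf_ext !ffunE.
all: congr (_ ==> (_ == _)); rewrite big_mkcond (big_vertex _ b).
all: rewrite child_to_root /= add0r -!big_mkcond.
all: under eq_bigl do rewrite child_ext.
all: under [X in _ + X]eq_bigl do rewrite child_ext.
(* A child lies on the same side as its parent, so one of the two sums is empty. *)
all: case: b; rewrite ?eqxx /= big_pred0_eq ?addr0 ?add0r; apply: eq_bigr.
all: by move=> c _; rewrite ffunE.
Qed.

Lemma codedB n (f g : {ffun vertex n -> 'rV['F_2]_L}) :
  coded f -> coded g -> coded (f - g).
Proof.
move=> /forallP cf /forallP cg; apply/forallP => v; apply/implyP => leafN.
have /implyP/(_ leafN)/eqP fv := cf v; have /implyP/(_ leafN)/eqP gv := cg v.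
rewrite !ffunE fv gv -sumrB; apply/eqP/eq_bigr => c _; by rewrite !ffunE.
Qed.

Lemma coded0 n : coded (0 : {ffun vertex n -> 'rV['F_2]_L}).
Proof.
apply/forallP => v; apply/implyP => _; rewrite ffunE big1 // => c _.
by rewrite ffunE.
Qed.

(** Codewords are closed under subtraction, so comparing two codewords amounts to testing their
    difference against zero. *)
Lemma decodableP n (S : {set vertex n}) :
  reflect (forall f : {ffun vertex n -> 'rV['F_2]_L},
             coded f -> {in S, forall v, f v = 0} ->
             forall y, is_leaf y -> f y = 0)
          (decodable L S).
Proof.
apply: (iffP forallP) => [dec f cf f0 y leaf_y | ker f].
  have /forallP/(_ 0)/implyP := dec f; rewrite cf coded0 /=.
  have -> : [forall v in S, f v == (0 : {ffun vertex n -> 'rV['F_2]_L}) v].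
    by apply/forall_inP => v Sv; rewrite ffunE f0.
  by move=> /(_ isT)/forallP/(_ y)/implyP/(_ leaf_y)/eqP ->; rewrite ffunE.
apply/forallP => g; apply/implyP => /and3P[cf cg /forall_inP fg].
apply/forall_inP => y leaf_y; rewrite -subr_eq0.
have := ker _ (codedB cf cg) _ _ leaf_y; rewrite !ffunE => -> // v Sv.
by rewrite !ffunE (eqP (fg v Sv)) subrr.
Qed.

Lemma coded_eq0 n (f : {ffun vertex n.+1 -> 'rV['F_2]_L}) :
  coded f -> (forall y, is_leaf y -> f y = 0) -> forall v, f v = 0.
Proof.
elim: n f => [|n IHn] f.
  by move=> _ f0 v; rewrite (vertex1_root v) f0 // is_leaf_root.
rewrite (codedE true) => /and3P[/eqP froot cft cff] f0.
have f0_ext b v : f (ext b v) = 0.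
  have cb : coded (restr b f) by case: b.
  have := IHn _ cb _ v; rewrite ffunE => -> // y leaf_y.
  by rewrite ffunE f0 // is_leaf_ext.
by elim/vertex_ind => [|b v]; rewrite ?froot !f0_ext ?addr0.
Qed.

Lemma coded_node n b (f g : {ffun vertex n.+1 -> 'rV['F_2]_L}) :
  coded f -> coded g ->
  coded (finfun (node b (f (root n) + g (root n)) f g)).
Proof.
move=> cf cg; rewrite (codedE b) !ffunE node_root node_ext node_extN eqxx /=.
have -> : restr b [ffun x => node b (f (root n) + g (root n)) f g x] = f.
  by apply/ffunP => v; rewrite !ffunE node_ext.
have -> : restr (~~ b) [ffun x => node b (f (root n) + g (root n)) f g x] = g.
  by apply/ffunP => v; rewrite !ffunE node_extN.
by rewrite cf.
Qed.

(** Put [a] at the leaf [y] and zero at all other leaves: taking XORs upwards copies [a] along the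
    path to the root and leaves zero elsewhere. *)
Lemma coded_path n (y : vertex n.+1) (a : 'rV['F_2]_L) : is_leaf y ->
  exists f : {ffun vertex n.+1 -> 'rV['F_2]_L},
    [/\ coded f, f (root n) = a & forall v, ~~ anc v y -> f v = 0].
Proof.
elim: n y => [|n IHn] y leaf_y.
  exists [ffun=> a]; split; [exact: coded1 | by rewrite ffunE |].
  by move=> v; rewrite (vertex1_root v) anc_root.
elim/vertex_ind: y leaf_y => [|b y]; first by rewrite is_leaf_root.
rewrite is_leaf_ext => /IHn[f [cf froot f0]].
exists (finfun (node b (f (root n) + (0 : {ffun _ -> _}) (root n)) f
  (0 : {ffun _ -> 'rV_L}))).
split; [exact: coded_node cf (coded0 _) | |].
  by rewrite ffunE node_root froot ffunE addr0.
elim/vertex_ind => [|c v]; first by rewrite anc_root.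
rewrite anc_ext ffunE; case: (eqVneq c b) => [->|neq_cb _].
  by rewrite node_ext => /f0.
rewrite (neq_negb neq_cb).
by rewrite node_extN ffunE.
Qed.

(* A codeword of the subtree off the missing path extends to the whole tree by
   carrying the fragment of its root down the missing path. *)
Lemma decodable_split n b (y : vertex n.+1) (S : {set vertex n.+2}) :
  is_leaf y -> root n.+1 \in S -> (forall v, anc v y -> ext b v \notin S) ->
  decodable L S =
    decodable L (subtree (~~ b) S) && decodable L (root n |: subtree b S).
Proof.
move=> leaf_y Sroot missing; apply/decodableP/andP => [ker | [kerN kerb] f cf f0].
  split; apply/decodableP => h ch h0 z leaf_z.
    (* The glued codeword must vanish at the present root: the value [- h (root n)] cancels
       [h (root n)], and [g] is nonzero only on the missing path. *)
    have [g [cg groot g0]] := coded_path (- h (root n)) leaf_y.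
    have := ker _ (coded_node b cg ch) _ (ext (~~ b) z) leaf_z.
    rewrite [LHS]ffunE node_extN; apply; elim/vertex_ind => [|c v] Sv.
      by rewrite [LHS]ffunE node_root groot addNr.
    rewrite [LHS]ffunE; case: (eqVneq c b) Sv => [->|neq_cb].
      rewrite node_ext => Sv; apply: g0; apply: contraL Sv; exact: missing.
    rewrite (neq_negb neq_cb).
    by rewrite node_extN => Sv; apply: h0; rewrite inE.
  (* With zero on the other side, the root carries the fragment [h (root n)], which is zero because
     [root n] was added to the subset. *)
  have := ker _ (coded_node b ch (coded0 _)) _ (ext b z) leaf_z.
  rewrite [LHS]ffunE node_ext; apply; elim/vertex_ind => [|c v] Sv.
    by rewrite [LHS]ffunE node_root (h0 (root n)) ?ffunE ?addr0 // !inE eqxx.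
  rewrite [LHS]ffunE; case: (eqVneq c b) Sv => [->|neq_cb].
    by rewrite node_ext => Sv; apply: h0; rewrite !inE Sv orbT.
  rewrite (neq_negb neq_cb).
  by rewrite node_extN ffunE.
move: cf; rewrite (codedE b) => /and3P[/eqP froot cb cNb].
have f0N v : f (ext (~~ b) v) = 0.
  suff: restr (~~ b) f v = 0 by rewrite ffunE.
  apply: (coded_eq0 cNb) => y'; apply: (decodableP _ kerN) => // w.
  by rewrite inE ffunE; apply: f0.
have f0b v : f (ext b v) = 0.
  suff: restr b f v = 0 by rewrite ffunE.
  apply: (coded_eq0 cb) => y'; apply: (decodableP _ kerb) => // w.
  rewrite !inE ffunE => /orP[/eqP-> | /f0 //].
  (* The root equation recovers the top fragment on side [b]: the root is present and the other
     child has fragment zero. *)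
  by move: froot; rewrite f0 // f0N addr0.
elim/vertex_ind => [|c v _]; first by rewrite is_leaf_root.
case: (eqVneq c b) => [->|neq_cb]; first exact: f0b.
rewrite (neq_negb neq_cb).
exact: f0N.
Qed.

End Coding.

(** * Counting topmost present vertices and the recovery cost *)

Lemma top_present1 (S : {set vertex 1}) : #|top_present S| = (root 0 \in S).
Proof.
have -> : top_present S = S.
  apply/setP => v; rewrite inE (vertex1_root v).
  by case: (_ \in S) => //=; apply/forallP => w; rewrite proper_anc_to_root.
rewrite -sum1_card big_mkcond (big_pred1 (root 0)) /=.
  by case: (_ \in S).
by move=> v; rewrite (vertex1_root v) /= eqxx.
Qed.

Lemma top_presentE n b (S : {set vertex n.+2}) :
  #|top_present S| =
    if root n.+1 \in S then 1%N
    else (#|top_present (subtree b S)| + #|top_present (subtree (~~ b) S)|)%N.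
Proof.
rewrite (card_vertex b) inE.
have -> : [forall w, proper_anc w (root n.+1) ==> (w \notin S)].
  by apply/forallP => w; rewrite proper_anc_to_root.
have subE c : subtree c (top_present S) =
    if root n.+1 \in S then set0 else top_present (subtree c S).
  apply/setP => v; rewrite 2!inE (forall_vertex c) proper_anc_root ext_eq_root /=.
  case: (root n.+1 \in S) => /=; first by rewrite andbF inE.
  rewrite !inE; congr (_ && _).
  (* The condition over the side [~~ c] is vacuous: no vertex there is an ancestor of one on side
     [c]. *)
  rewrite [X in _ && X](_ : _ = true) ?andbT; last first.
    by apply/forallP => w; rewrite proper_anc_ext; case: c.
  by apply: eq_forallb => w; rewrite proper_anc_ext eqxx !inE.
by rewrite !subE; case: ifP => // _; rewrite !cards0.
Qed.

Lemma top_below_rootE n b (S : {set vertex n.+2}) :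
  #|top_below S (root n.+1)| =
    (#|top_present (subtree b S)| + #|top_present (subtree (~~ b) S)|)%N.
Proof.
rewrite (card_vertex b) inE proper_anc_root eqxx andbF add0n.
suff subE c : subtree c (top_below S (root n.+1)) = top_present (subtree c S).
  by rewrite !subE.
apply/setP => v; rewrite 2!inE proper_anc_root ext_eq_root !inE; congr (_ && _).
rewrite (forall_vertex c) proper_anc_root eqxx /=.
rewrite [X in _ && X](_ : _ = true) ?andbT; last first.
  by apply/forallP => w; rewrite proper_anc_ext; case: c.
by apply: eq_forallb => w; rewrite proper_anc_ext eqxx inE.
Qed.

Lemma top_below_root1 (S : {set vertex 1}) : #|top_below S (root 0)| = 0%N.
Proof.
apply/eqP; rewrite cards_eq0; apply/eqP/setP => v.
by rewrite (vertex1_root v) !inE proper_anc_root eqxx andbF.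
Qed.

(** Turns the contribution of the path side into the cost of the leaf in the smaller tree with its
    root declared present. *)
Lemma top_present_root n (S : {set vertex n.+1}) : root n \notin S ->
  #|top_present S| = #|top_below (root n |: S) (root n)|.
Proof.
case: n S => [|n] S Sroot; first by rewrite top_present1 (negPf Sroot) top_below_root1.
have subE c : subtree c (root n.+1 |: S) = subtree c S.
  by apply/setP => v; rewrite !inE ext_eq_root.
by rewrite (top_presentE true) (top_below_rootE true) (negPf Sroot) !subE.
Qed.

(** Topmost present vertices lie above disjoint nonempty sets of leaves. This gives the upper
    summation limit of the recurrence. *)
Lemma top_present_le n (S : {set vertex n.+1}) : (#|top_present S| <= 2 ^ n)%N.
Proof.
elim: n S => [|n IHn] S; first by rewrite top_present1; case: (_ \in S).
rewrite (top_presentE true); case: ifP => _; first by rewrite expn_gt0.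
by rewrite expnS mul2n -addnn leq_add.
Qed.

Lemma top_present_eq0 n (S : {set vertex n.+1}) :
  #|top_present S| = 0%N -> S = set0.
Proof.
elim: n S => [|n IHn] S.
  rewrite top_present1 => S0; apply/setP => v; rewrite (vertex1_root v) inE.
  by case: (_ \in S) S0.
rewrite (top_presentE true); case: ifP => // Sroot /eqP; rewrite addn_eq0.
case/andP=> /eqP/IHn/setP St /eqP/IHn/setP Sf; apply/setP.
elim/vertex_ind => [|b v]; first by rewrite inE.
by case: b; [have := St v | have := Sf v]; rewrite !inE.
Qed.

(** Without topmost present vertices the subset is empty, and then a codeword with all-ones root
    fragment, nonzero since [0 < L], goes undetected. This gives the lower summation limit of the
    recurrence. *)
Lemma decodable_top_present_gt0 L n (S : {set vertex n.+1}) :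
  (0 < L)%N -> decodable L S -> (0 < #|top_present S|)%N.
Proof.
move=> L_gt0 /decodableP ker; rewrite lt0n; apply/eqP => /top_present_eq0 S0.
have leaf_y : is_leaf (bseq_of_tuple (nseq_tuple n false) : vertex n.+1).
  by rewrite /is_leaf /layer size_nseq subSnn.
have [f [cf froot _]] := coded_path (const_mx 1 : 'rV['F_2]_L) leaf_y.
have : f (root n) = 0.
  by apply: (coded_eq0 cf) => y; apply: ker => // v; rewrite S0 inE.
by rewrite froot => /rowP/(_ (Ordinal L_gt0))/eqP; rewrite !mxE oner_eq0.
Qed.

(* For n = 0 the left-hand side is the cost 0 of a present leaf. *)
Lemma recovered_with_root n (y : vertex n.+1) (S : {set vertex n.+1}) N :
  is_leaf y -> root n \in S ->
  (forall v, anc v y -> v != root n -> v \notin S) ->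
  recovered_with S y N = (N == #|top_below S (root n)|%:Z).
Proof.
move=> leaf_y Sroot missing; rewrite /recovered_with.
case: n y S leaf_y Sroot missing => [|n] y S leaf_y Sroot missing.
  by rewrite (vertex1_root y) Sroot top_below_root1.
elim/vertex_ind: y leaf_y missing => [|b y] leaf_y missing.
  by rewrite is_leaf_root in leaf_y.
rewrite (negPf (missing _ (anc_refl _) _)) ?ext_eq_root //.
apply/existsP/idP => [[x /andP[/andP[Sx /existsP[c /andP[xc cy]]]]] | cost].
  (* A vertex that recovers [y] is a present ancestor of [y], and all ancestors other than the root
     are missing. *)
  suff -> : x = root n.+1 by [].
  apply/eqP; apply: contraLR Sx => x_root; apply: missing => //.
  case/andP: xc => xc _; case/andP: cy => cy _; exact: prefix_trans xc cy.
exists (root n.+1); rewrite cost andbT /recovers Sroot /=.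
apply/existsP; exists (ext b (root n)); rewrite child_root_ext eqxx /=.
rewrite /missing_path anc_ext eqxx anc_root /=.
apply/forallP; elim/vertex_ind => [|c v]; apply/implyP => /andP[cv vy] //.
by apply: missing; rewrite ?ext_eq_root.
Qed.

(** * Product measures on subsets of the tree *)

Section Probability.
Variable R : realType.

Definition weight i (q : vertex i -> R) (S : {set vertex i}) : R :=
  \prod_(v : vertex i) (if v \in S then q v else 1 - q v).

(** A subset containing a vertex of probability 0, or omitting one of probability 1, has a zero
    factor in its weight. *)
Lemma eq_prob_support i (q : vertex i -> R) (E E' : pred {set vertex i}) :
  (forall S : {set vertex i}, (forall v, q v = 0 -> v \notin S) ->
             (forall v, q v = 1 -> v \in S) -> E S = E' S) ->
  prob q E = prob q E'.
Proof.
move=> eqE; rewrite /prob big_mkcond [RHS]big_mkcond; apply: eq_bigr => S _.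
case: (boolP [forall v, ((q v == 0) ==> (v \notin S)) &&
                        ((q v == 1) ==> (v \in S))]) => [/forallP supp|].
  rewrite (eqE S) // => v /eqP qv; have /andP[s0 s1] := supp v.
    by move: s0; rewrite qv.
  by move: s1; rewrite qv.
case/forallPn => v; rewrite negb_and !negb_imply andbT => null.
rewrite (bigD1 v) //= (_ : (if v \in S then _ else _) = 0) ?mul0r ?if_same //.
by case/orP: null => /andP[/eqP-> vS]; [rewrite vS | rewrite (negPf vS) subrr].
Qed.

(** Adding [x] is a weight-preserving bijection from the subsets without [x], which carry all the
    weight of [q0], onto those with [x], which carry all the weight of [q]. *)
Lemma prob_setU1 i (x : vertex i) (q q0 : vertex i -> R)
    (E : pred {set vertex i}) :
  q x = 1 -> q0 x = 0 -> (forall v, v != x -> q0 v = q v) ->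
  prob q E = prob q0 (fun S => E (x |: S)).
Proof.
move=> qx q0x q0E.
rewrite (@eq_prob_support _ q _ (fun S => E S && (x \in S))); last first.
  by move=> S _ /(_ x qx) ->; rewrite andbT.
rewrite (@eq_prob_support _ q0 _ (fun S => E (x |: S) && (x \notin S))); last first.
  by move=> S /(_ x q0x) -> _; rewrite andbT.
rewrite /prob (reindex_onto (fun S => x |: S) (fun S => S :\ x)) /=; last first.
  by move=> S /andP[_ xS]; rewrite setD1K.
have xUD S : ((x |: S) :\ x == S) = (x \notin S).
  by apply/eqP/idP => [eqS|/setU1K //]; rewrite -[S]eqS setD11.
apply: eq_big => S; first by rewrite xUD setU11 andbT.
rewrite xUD => /andP[_ xS]; apply: eq_bigr => v _; rewrite !inE.
by case: eqVneq => [->|/q0E->] //=; rewrite qx q0x (negPf xS) subr0.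
Qed.

Lemma sum_sets n b (G : bool -> {set vertex n.+1} -> {set vertex n.+1} -> R) :
  \sum_(S : {set vertex n.+2})
     G (root n.+1 \in S) (subtree b S) (subtree (~~ b) S) =
  \sum_r \sum_S1 \sum_S2 G r S1 S2.
Proof.
under [RHS]eq_bigr do rewrite pair_big /=.
rewrite pair_big /=; symmetry.
rewrite (reindex (fun S : {set vertex n.+2} =>
  (root n.+1 \in S, (subtree b S, subtree (~~ b) S)))) //=.
exists (fun t : bool * ({set vertex n.+1} * {set vertex n.+1}) =>
  [set v | node b t.1 (mem t.2.1) (mem t.2.2) v]) => [S _ | [r [S1 S2]] _] /=.
  apply/setP; elim/vertex_ind => [|c v]; rewrite inE ?node_root //.
  have [->|/neq_negb->] := eqVneq c b; first by rewrite node_ext !inE.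
  by rewrite node_extN !inE.
congr (_, (_, _)); first by rewrite inE node_root.
  by apply/setP => v; rewrite !inE node_ext.
by apply/setP => v; rewrite !inE node_extN.
Qed.

(** Independence of the two sides. The event ignores the root, whose two factors [q] and [1 - q] add
    up to 1. *)
Lemma prob_split n b (q : vertex n.+2 -> R) (q1 q2 : vertex n.+1 -> R)
    (E : {set vertex n.+1} -> {set vertex n.+1} -> bool) :
  (forall v, q (ext b v) = q1 v) -> (forall v, q (ext (~~ b) v) = q2 v) ->
  prob q (fun S => E (subtree b S) (subtree (~~ b) S)) =
  \sum_S2 weight q2 S2 * prob q1 (E^~ S2).
Proof.
move=> qb qNb; rewrite /prob big_mkcond /=.
pose G r S1 S2 := if E S1 S2 then
  (if r then q (root n.+1) else 1 - q (root n.+1)) * (weight q1 S1 * weight q2 S2)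
  else 0.
rewrite (eq_bigr (fun S : {set vertex n.+2} =>
    G (root n.+1 \in S) (subtree b S) (subtree (~~ b) S))); last first.
  move=> S _; rewrite /G; case: ifP => // _; rewrite (big_vertex _ b) /=.
  congr (_ * (_ * _)); apply: eq_bigr => v _; first by rewrite qb inE.
  by rewrite qNb inE.
rewrite sum_sets big_bool /= exchange_big [X in _ + X]exchange_big -big_split /=.
apply: eq_bigr => S2 _; rewrite -big_split mulr_sumr [RHS]big_mkcond /=.
apply: eq_bigr => S1 _; rewrite /G; case: ifP => _; last by rewrite addr0.
by rewrite -mulrDl addrC subrK mul1r mulrC.
Qed.

(** * The recurrence and its initial values *)

Variables (p : nat -> R) (L : nat).

Lemma A_cost_root n (y : vertex n.+1) N : is_leaf y ->
  A p L y N = prob (cond_presence p y)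
                (fun S => decodable L S && (N == #|top_below S (root n)|%:Z)).
Proof.
move=> leaf_y; apply: eq_prob_support => S supp0 supp1.
rewrite (recovered_with_root _ leaf_y) //.
  by apply: supp1; rewrite /cond_presence is_rootE eqxx.
move=> v vy v_root; apply: supp0.
by rewrite /cond_presence is_rootE (negPf v_root) vy.
Qed.

(** The recurrence before grouping by count: [S] is the subset off the path, and its topmost present
    vertices use up part of the cost [N]. *)
Lemma A_step n b (y : vertex n.+1) N : is_leaf y ->
  A p L (ext b y) N =
    \sum_(S | decodable L S) weight (fun v : vertex n.+1 => p (layer v)) S *
                             A p L y (N - #|top_present S|%:Z).
Proof.
move=> leaf_y; rewrite A_cost_root //.
(* Under [q1] the child of the root on the path is still missing; [prob_setU1] finally exchanges
   this for [cond_presence p y], where it is present. *)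
pose q1 v := if anc v y then 0 else p (layer v).
pose E (S1 S2 : {set vertex n.+1}) :=
  decodable L S2 && (decodable L (root n |: S1) &&
  (N - #|top_present S2|%:Z == #|top_below (root n |: S1) (root n)|%:Z)).
rewrite (@eq_prob_support _ _ _ (fun S => E (subtree b S) (subtree (~~ b) S)));
  last first.
  move=> S supp0 supp1.
  have missing v : anc v y -> ext b v \notin S.
    by move=> vy; apply: supp0; rewrite /cond_presence is_rootE ext_eq_root anc_ext eqxx vy.
  have rootS : root n.+1 \in S by apply: supp1; rewrite /cond_presence is_rootE eqxx.
  rewrite (decodable_split L leaf_y rootS missing) (top_below_rootE b) /E.
  rewrite -top_present_root ?inE ?missing ?anc_root // -!andbA.
  by rewrite PoszD subr_eq.
have qb v : cond_presence p (ext b y) (ext b v) = q1 v.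
  by rewrite /cond_presence is_rootE ext_eq_root anc_ext eqxx.
have qNb v : cond_presence p (ext b y) (ext (~~ b) v) = p (layer v).
  by rewrite /cond_presence is_rootE ext_eq_root anc_ext; case: (b).
rewrite (prob_split _ qb qNb).
rewrite [RHS]big_mkcond /=; apply: eq_bigr => S2 _; rewrite /E.
case: ifP => _; last by rewrite /prob big_pred0_eq mulr0.
congr (_ * _); rewrite A_cost_root //; symmetry; apply: prob_setU1.
- by rewrite /cond_presence is_rootE eqxx.
- by rewrite /q1 anc_root.
- by move=> v /negPf v_root; rewrite /cond_presence is_rootE v_root.
Qed.

(** The right-hand side of [A_step] does not involve [b], and by induction it does not depend on the
    leaf of the smaller tree. *)
Lemma A_leaf n (y y' : vertex n.+1) N : is_leaf y -> is_leaf y' ->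
  A p L y N = A p L y' N.
Proof.
elim: n y y' N => [|n IHn] y y' N; first by rewrite (vertex1_root y) (vertex1_root y').
elim/vertex_ind: y => [|b y]; first by rewrite is_leaf_root.
elim/vertex_ind: y' => [|b' y']; first by rewrite is_leaf_root.
rewrite !is_leaf_ext => leaf_y leaf_y'; rewrite !A_step //.
by apply: eq_bigr => S _; rewrite (IHn _ y').
Qed.

Lemma A_recurrence n (y : vertex n.+2) (y' : vertex n.+1) N :
  (0 < L)%N -> is_leaf y -> is_leaf y' ->
  A p L y N = \sum_(1 <= l < (2 ^ n).+1) F p L n.+1 l * A p L y' (N - l%:Z).
Proof.
move=> L_gt0; elim/vertex_ind: y => [|b y]; first by rewrite is_leaf_root.
rewrite is_leaf_ext => leaf_y leaf_y'; rewrite A_step //.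
under [RHS]eq_bigr do rewrite /F /prob mulr_suml.
rewrite (exchange_big_dep (decodable L)) /=; last by move=> l S _ /andP[].
apply: eq_bigr => S decS.
under [RHS]eq_bigl do rewrite decS eq_sym /=.
(* Each decodable [S] contributes to exactly one [l], its number of topmost present vertices, which
   lies in the summation range. *)
rewrite big_nat1_eq ltnS top_present_le (decodable_top_present_gt0 L_gt0) //=.
by rewrite (A_leaf _ leaf_y leaf_y').
Qed.

Lemma weight1 (q : vertex 1 -> R) S :
  weight q S = if root 0 \in S then q (root 0) else 1 - q (root 0).
Proof.
rewrite /weight (bigD1 (root 0)) //= big1 ?mulr1 // => v.
by rewrite (vertex1_root v) eqxx.
Qed.

Lemma decodable1 (S : {set vertex 1}) : (0 < L)%N ->
  decodable L S = (root 0 \in S).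
Proof.
move=> L_gt0; apply/idP/idP => [decS | rootS].
  by have := decodable_top_present_gt0 L_gt0 decS; rewrite top_present1 lt0b.
by apply/decodableP => f _ f0 y _; rewrite (vertex1_root y) f0.
Qed.

Lemma prob1 (q : vertex 1 -> R) (E : pred {set vertex 1}) :
  (forall S, E S = (root 0 \in S)) -> prob q E = q (root 0).
Proof.
move=> ES; rewrite /prob (big_pred1 [set root 0]).
  by rewrite -/(weight _ _) weight1 inE eqxx.
move=> S; rewrite /= ES; apply/idP/eqP => [rootS | ->]; last by rewrite inE.
by apply/setP => v; rewrite (vertex1_root v) rootS inE eqxx.
Qed.

Lemma F1 : (0 < L)%N -> F p L 1 1 = p 1%N.
Proof.
move=> L_gt0; rewrite /F prob1 ?/layer //= => S.
by rewrite decodable1 // top_present1; case: (_ \in S).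
Qed.

Lemma A1 (y : vertex 1) N : (0 < L)%N -> A p L y N = (N == 0)%:R.
Proof.
move=> L_gt0; rewrite A_cost_root; last by rewrite (vertex1_root y) is_leaf_root.
case: eqVneq => [->|N0].
  rewrite prob1 => [|S]; first by rewrite /cond_presence is_rootE eqxx.
  by rewrite decodable1 // top_below_root1 andbT.
by rewrite /prob big_pred0 // => S; rewrite top_below_root1 (negPf N0) andbF.
Qed.

Lemma A_neg i (y : vertex i) (N : int) : N < 0 -> A p L y N = 0.
Proof.
move=> N_lt0; rewrite /A /prob big_pred0 // => S.
rewrite /recovered_with; apply/negbTE; rewrite negb_and orbC; case: ifP => _.
  by rewrite lt_eqF.
rewrite negb_exists; apply/orP; left; apply/forallP => x.
by rewrite negb_and orbC lt_eqF // (lt_le_trans N_lt0).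
Qed.

End Probability.

Theorem lemma20 (R : realType) (p : nat -> R)
    (hp : forall j : nat, (1 <= j)%N -> 0 <= p j <= 1)
    (L : nat) (hL : (0 < L)%N) :
  [/\ forall (i : nat) (y : vertex i) (y' : vertex (i - 1)) (N : int),
        (2 < i)%N -> is_leaf y -> is_leaf y' ->
        A p L y N =
          \sum_(1 <= l < (2 ^ (i - 2)).+1) F p L (i - 1) l * A p L y' (N - l%:Z),
      forall y : vertex 2, is_leaf y -> A p L y 1 = p 1%N,
      forall (y : vertex 2) (N : int), is_leaf y -> N <> 1 -> A p L y N = 0
    & forall (i : nat) (y : vertex i) (N : int),
        (2 <= i)%N -> is_leaf y -> N < 0 -> A p L y N = 0].
Proof.
have A2 (y : vertex 2) N : is_leaf y -> A p L y N = p 1%N * (N == 1)%:R.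
  (* For [T_2] the recurrence has the single term [l = 1], namely [F_1(1) = p_1] times the indicator
     that [N - 1] is the cost 0 in [T_1]. *)
  move=> leaf_y; rewrite (A_recurrence p (y' := root 0) N hL leaf_y) ?is_leaf_root //.
  by rewrite big_nat1 F1 // A1 // subr_eq0.
split=> [[|[|[|n]]] // y y' N _ leaf_y leaf_y' | y leaf_y | y N leaf_y | i y N _ _].
- exact: A_recurrence.
- by rewrite A2 // eqxx mulr1.
- by move=> /eqP/negPf N1; rewrite A2 // N1 mulr0.
- exact: A_neg.
Qed.
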